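(* Let $N\in\mathbb{N}$ and let $s_0=1,s_1,\ldots,s_{2N-1}$ be real numbers. The numbers $(s_0,s_1,s_2,\ldots,s_{2N-1})$ are moments of a spectral measure, supported on $(0,1)$, corresponding to a Jacobi operator $A^N$ with Dirichlet boundary condition at $n=N+1$ (that is, there is an $N\times N$ Jacobi matrix $A^N$ whose spectral measure $d\rho^N$ is supported on $(0,1)$ and satisfies $s_k=\int_{-\infty}^\infty\lambda^k\,d\rho^N(\lambda)$ for $k=0,1,\ldots,2N-1$) if and only if the condition $$S^N_0\geqslant S^N_1>0$$ holds.
   Context: An $N\times N$ Jacobi matrix $A^N$ is a real symmetric tridiagonal matrix with diagonal $b_1,\ldots,b_N\in\mathbb{R}$ and off-diagonal entries $a_1,\ldots,a_{N-1}>0$; set $a_0=1$. It corresponds to the difference expression $a_n\psi_{n+1}+a_{n-1}\psi_{n-1}+b_n\psi_n$ on $\{1,\ldots,N\}$ with $\psi_0=0$ and Dirichlet condition $\psi_{N+1}=0$. Let $\lambda_1,\ldots,\lambda_N$ be its (real, distinct) eigenvalues and let $\phi^k\in\mathbb{R}^N$ be the eigenvector for $\lambda_k$ normalized by $\phi^k_1=1$; put $\rho_k=(\phi^k,\phi^k)$. The spectral measure of $A^N$ is $d\rho^N$ with $\rho^N(\lambda)=\sum_{\{k:\lambda_k<\lambda\}}1/\rho_k$, i.e. mass $1/\rho_k$ at each $\lambda_k$ (total mass $1$). $S^N_m$ is the $N\times N$ Hankel-type matrix with entries $(S^N_m)_{ij}=s_{2N-i-j+m}$, $i,j=1,\ldots,N$.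 For symmetric matrices, $X\geqslant Y$ means $X-Y$ is positive semidefinite and $X>0$ means $X$ is positive definite.
   Formalization: The support interval (0,1) is replaced by (0,1], closed at 1: as stated the claim fails, e.g. for N=1 and s_0=s_1=1, where S_0=S_1=(1) satisfies the condition but the only spectral measure is a unit mass at 1. *)

(* Defs.v *)
From HB Require Import structures.
From mathcomp Require Import all_boot all_order all_algebra finmap.
From mathcomp Require Import all_classical all_reals all_analysis.
Set Implicit Arguments. Unset Strict Implicit. Unset Printing Implicit Defensive.
Import Order.TTheory GRing.Theory Num.Theory.
Local Open Scope classical_set_scope.
Local Open Scope ring_scope.

Definition jacobi (R : realType) (N : nat) (A : 'M[R]_N) : Prop :=
  [/\ A^T = A,
      forall i j : 'I_N, (i.+1 < j)%N -> A i j = 0 &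
      forall i j : 'I_N, j = i.+1 :> nat -> 0 < A i j].

(* [fset_set] returns the empty set on an infinite set; the set of eigenvalues
   of a matrix is always finite. *)
Definition eigenvalues (R : realType) (N : nat) (A : 'M[R]_N) : seq R :=
  fset_set [set x : R | eigenvalue A x].

(* The eigenvector for [x] whose first component is 1. For a Jacobi matrix and
   an eigenvalue [x] it exists and is unique. *)
Definition normalized_eigenvector (R : realType) (N : nat) (A : 'M[R]_N) (x : R)
    : 'cV[R]_N :=
  xget 0 [set v : 'cV[R]_N | A *m v = x *: v /\
                             forall i : 'I_N, i = 0%N :> nat -> v i 0 = 1].

Definition norming_constant (R : realType) (N : nat) (A : 'M[R]_N) (x : R) : R :=
  \sum_(i < N) normalized_eigenvector A x i 0 ^+ 2.

Lemma norming_constantV_ge0 (R : realType) (N : nat) (A : 'M[R]_N) (x : R) :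
  0 <= (norming_constant A x)^-1.
Proof. by rewrite invr_ge0; apply: sumr_ge0 => i _; exact: sqr_ge0. Qed.

Definition spectral_measure (R : realType) (N : nat) (A : 'M[R]_N)
    : {measure set (measurableTypeR R) -> \bar R} :=
  msum (fun k => let x := nth 0 (eigenvalues A) k in
          mscale (NngNum (norming_constantV_ge0 A x))
                 (@dirac _ (measurableTypeR R) x R))
       (size (eigenvalues A)).

(* An atom at 1 is compatible with S_0 >= S_1 > 0 (for N = 1, take s_1 = 1), so
   the support that matches this condition is ]0, 1], closed on the right,
   whereas the source writes (0, 1). *)
Definition supported_on (R : realType)
    (mu : {measure set (measurableTypeR R) -> \bar R}) (D : set R) : Prop :=
  mu (~` D) = 0%E.

(* Indices start at 0, so that the entry s_{2N-i-j+m} with i, j = 1, ..., N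
   appears with [i.+1] and [j.+1]; the subtraction is never truncated. *)
Definition hankel (R : realType) (N m : nat) (s : nat -> R) : 'M[R]_N :=
  \matrix_(i < N, j < N) s (2 * N - i.+1 - j.+1 + m)%N.

Definition posdefmx (R : realType) (N : nat) (X : 'M[R]_N) : Prop :=
  X^T = X /\ forall v : 'cV[R]_N, v != 0 -> 0 < (v^T *m X *m v) 0 0.

Definition possemidefmx (R : realType) (N : nat) (X : 'M[R]_N) : Prop :=
  X^T = X /\ forall v : 'cV[R]_N, 0 <= (v^T *m X *m v) 0 0.

(* Main.v *)
(** For a Jacobi matrix A, the row e_0 A^k vanishes beyond entry k and is
positive at entry k, so no polynomial of degree < N annihilates A; by the
spectral theorem A therefore has N distinct real eigenvalues. The normalized
eigenvectors are orthogonal, whence (A^k)_{00} is the sum of x^k / rho_x over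
the eigenvalues x, which is the k-th moment of the spectral measure.

If the s_k are these moments, then the quadratic form of S_m at v is the
integral of x^m p_v(x)^2, where p_v is the polynomial of degree < N with
coefficients v. With N atoms in ]0, 1] this gives S_0 >= S_1 > 0.

Conversely, reverse the indices and let H_m = (s_{i+j+m})_{ij}. Then H_0 is
positive definite, so H_0 = L L^T with L lower triangular; put
A = L^-1 H_1 L^-T. Since column j of H_1 is column j+1 of H_0, A maps column j
of L^T to column j+1. Hence A is Jacobi, column k of L^T is A^k e_0, and
(A^(2j+m))_{00} = (L A^m L^T)_{jj} = s_{2j+m} for m = 0, 1. The eigenvalues
of A are those of the pencil (H_1, H_0), which lie in ]0, 1]. *)

Require Import Defs.
From mathcomp Require Import all_boot all_order all_algebra.
From mathcomp Require Import all_classical all_reals all_analysis.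
From mathcomp Require Import measurable_realfun complex zify ring.
Set Implicit Arguments. Unset Strict Implicit.
Unset Printing Implicit Defensive.
Import Order.TTheory GRing.Theory Num.Theory.
Local Open Scope classical_set_scope.
Local Open Scope ring_scope.

(** * Diagonalization of real symmetric matrices *)

(** Over the complex closure [A] is Hermitian, hence unitarily diagonalizable with a real diagonal.
    The list [rs] later serves both to show the spectrum finite and to bound its size from below. *)
Lemma symmetric_annihilator (R : rcfType) (n : nat) (A : 'M[R]_n.+1) :
  A^T = A ->
  exists rs : seq R, [/\ uniq rs, {subset rs <= eigenvalue A} &
    horner_mx A (\prod_(x <- rs) ('X - x%:P)) = 0].
Proof.
move=> symA.
pose C := complex R : numClosedFieldType.
pose toC : {rmorphism R -> C} := real_complex R.
pose B : 'M[C]_n.+1 := map_mx toC A.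
have hermB : B \is hermsymmx.
  apply: realsym_hermsym.
    apply/is_hermitianmxP.
    by rewrite expr0 scale1r map_mx_id // map_trmx symA.
  by apply/mxOverP => i j; rewrite mxE; apply/complex_realP; exists (A i j).
have /mxOverP dreal := hermitian_spectral_diag_real hermB.
have /orthomx_spectralP := hermitian_normalmx hermB.
set P := spectralmx B; set d := spectral_diag B => Beq.
have unitP : P \in unitmx := spectral_unit _.
pose x i := complex.Re (d 0 i).
have dE i : d 0 i = toC (x i) by rewrite /toC /x /= RRe_real.
(* For a diagonalizable matrix one linear factor per distinct diagonal entry suffices, so
   repetitions are dropped. *)
exists (undup (codom x)); split; first exact: undup_uniq.
  move=> y; rewrite mem_undup => /codomP[i ->].
  rewrite -topredE /=; rewrite -(eigenvalue_map toC) -/B -dE.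
  (* Since P B = diag(d) P, the rows of the invertible matrix [P] are left eigenvectors. *)
  apply/eigenvalueP; exists (row i P).
    rewrite -row_mul {1}Beq !mulmxA mulmxV // mul1mx row_mul row_diag_mx.
    by rewrite -scalemxAl -rowE.
  apply: contraTneq unitP => Pi0; rewrite unitmxE.
  rewrite (expand_det_row _ i) big1 ?unitr0 // => j _.
  by move/rowP/(_ j): Pi0; rewrite !mxE => ->; rewrite mul0r.
apply: (map_mx_inj (f := toC)); rewrite map_horner_mx map_mx0 -/B.
rewrite Beq horner_mx_uconjC // horner_mx_diag.
set p := \prod_(z <- _) _.
suff -> : map_mx (horner (map_poly toC p)) d = 0.
  by rewrite (raddf0 diag_mx) mulmx0 mul0mx.
apply/rowP => i; rewrite !mxE dE horner_map /=.
suff /rootP -> : root p (x i) by rewrite rmorph0.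
by rewrite root_prod_XsubC mem_undup codom_f.
Qed.

(** * Quadratic forms and the Cholesky factorization *)

Lemma mx_quadE (R : comNzRingType) (n : nat) (X : 'M[R]_n) (v : 'cV[R]_n) :
  (v^T *m X *m v) 0 0 = \sum_(i < n) \sum_(j < n) v i 0 * v j 0 * X i j.
Proof.
rewrite exchange_big mxE; apply: eq_bigr => j _ /=.
rewrite mxE big_distrl /=; apply: eq_bigr => i _.
by rewrite mxE -!mulrA [X i j * _]mulrC.
Qed.

(** Applied with [rev_ord], this undoes the reversed indexing of [hankel]. *)
Lemma mx_quad_mxsub (R : comNzRingType) (n : nat) (X : 'M[R]_n)
    (f : 'I_n -> 'I_n) (v : 'cV[R]_n) :
  involutive f ->
  (v^T *m mxsub f f X *m v) 0 0 =
  ((\col_i v (f i) 0)^T *m X *m (\col_i v (f i) 0)) 0 0.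
Proof.
move=> fK; rewrite !mx_quadE (reindex_inj (inv_inj fK)).
apply: eq_bigr => i _; rewrite (reindex_inj (inv_inj fK)).
by apply: eq_bigr => j _; rewrite !mxE !fK.
Qed.

(** Induction on the size: the first row and column are split off, and the Schur complement [S] is
    again positive definite. The inverse [T] of [L] is carried along because its triangular shape is
    used to locate zeros of the Jacobi matrix. *)
Lemma posdefmx_cholesky (R : realType) (n : nat) (X : 'M[R]_n) :
  posdefmx X ->
  exists L T : 'M[R]_n,
    [/\ X = L *m L^T, L *m T = 1%:M,
        is_trig_mx L, is_trig_mx T & forall i, 0 < L i i].
Proof.
elim: n X => [|n IH] X [symX posX].
  exists 0, 0; split; try by apply/matrixP => -[].
  - by apply/is_trig_mxP => -[].
  - by apply/is_trig_mxP => -[].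
  - by case.
rewrite -[n.+1]/(1 + n)%N in X symX posX *.
pose a : R := X 0 0.
pose r : 'cV[R]_n := dlsubmx X.
pose B : 'M[R]_n := drsubmx X.
have aE : ulsubmx X = a%:M.
  rewrite [LHS]mx11_scalar; congr (_%:M); rewrite !mxE.
  by congr (X _ _); apply/val_inj.
have rE : ursubmx X = r^T by rewrite /r -[in RHS]symX trmx_dlsub trmxK.
have XE : X = block_mx a%:M r^T r B by rewrite -aE -rE submxK.
have symB : B^T = B by rewrite /B trmx_drsub symX.
have qE (c : R) (w : 'cV[R]_n) : let v := col_mx c%:M w in
   (v^T *m X *m v) 0 0 =
   c ^+ 2 * a + c * (r^T *m w) 0 0 *+ 2 + (w^T *m B *m w) 0 0.
  rewrite /= XE tr_col_mx mul_row_block mul_row_col tr_scalar_mx.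
  rewrite !mulmxDl !mul_scalar_mx -!scalemxAl !mul_mx_scalar !mxE.
  rewrite mulr1n.
  have -> : \sum_j w^T 0 j * r j 0 = \sum_j r^T 0 j * w j 0.
    by apply: eq_bigr => j _; rewrite !mxE mulrC.
  by rewrite expr2 -mulrA mulr2n !addrA.
have a_gt0 : 0 < a.
  have := posX (col_mx 1%:M 0); rewrite qE !mulmx0 !mxE expr1n mul1r !mulr0.
  rewrite mul0rn !addr0; apply.
  by rewrite col_mx_eq0 negb_and oner_neq0.
pose S : 'M[R]_n := B - a^-1 *: (r *m r^T).
(* Evaluate the form of X at the vector (c, w) whose c minimizes it. *)
have posS : posdefmx S.
  split; first by rewrite /S linearB linearZ /= trmx_mul trmxK symB.
  move=> w w0.
  have := posX (col_mx (- (a^-1 * (r^T *m w) 0 0))%:M w); rewrite qE sqrrN.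
  rewrite col_mx_eq0 negb_and w0 orbT => /(_ isT).
  set b := (r^T *m w) 0 0; set Q := (w^T *m B *m w) 0 0 => h.
  have -> : (w^T *m S *m w) 0 0 = Q - a^-1 * b ^+ 2.
    have rwE : r^T *m w = b%:M by rewrite [LHS]mx11_scalar.
    have wrE : w^T *m r = b%:M.
      by rewrite -[LHS]trmxK trmx_mul trmxK rwE tr_scalar_mx.
    have entryB (U V : 'M[R]_1) : (U - a^-1 *: V) 0 0 = U 0 0 - a^-1 * V 0 0.
      by rewrite !mxE.
    rewrite /S mulmxBr mulmxBl -scalemxAr -scalemxAl mulmxA.
    rewrite -(mulmxA (w^T *m r)).
    by rewrite entryB rwE wrE -scalar_mxM [X in _ * X]mxE mulr1n.
  suff <- : (a^-1 * b) ^+ 2 * a + - (a^-1 * b) * b *+ 2 + Q = Q - a^-1 * b ^+ 2.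
    by [].
  by field; rewrite gt_eqF.
have [L [T [SE LT trL trT Lpos]]] := IH S posS.
pose q := Num.sqrt a.
have q_gt0 : 0 < q by rewrite sqrtr_gt0.
have q2 : q * q = a by rewrite -expr2 sqr_sqrtr // ltW.
(* The first column of the factor is that of X divided by [q], the square root of [a]. The lower
   left block of the inverse is forced by block multiplication. *)
exists (block_mx q%:M 0 (q^-1 *: r) L),
  (block_mx q^-1%:M 0 (- a^-1 *: (T *m r)) T).
split.
- rewrite XE tr_block_mx mulmx_block !trmx0 !mulmx0 !mul0mx !addr0.
  rewrite tr_scalar_mx !mul_mx_scalar !mul_scalar_mx scale_scalar_mx q2.
  rewrite linearZ /=.
  rewrite !scalerA divff ?gt_eqF // !scale1r -scalemxAl -scalemxAr scalerA.
  by rewrite -invfM q2 -SE /S addrC subrK.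
- rewrite mulmx_block !mulmx0 !mul0mx !addr0 add0r LT.
  rewrite mul_scalar_mx scale_scalar_mx divff ?gt_eqF //.
  rewrite mul_mx_scalar scalerA -invfM q2 -scalemxAr mulmxA LT mul1mx.
  by rewrite scaleNr subrr -scalar_mx_block.
- apply/is_trig_mxP => i j.
  case: (split_ordP i) => i' ->; case: (split_ordP j) => j' ->;
    rewrite ?block_mxEul ?block_mxEur ?block_mxEdl ?block_mxEdr ?mxE //=.
  + by rewrite !ord1.
  + by rewrite (ord1 j').
  + by rewrite ltn_add2l; apply/is_trig_mxP.
- apply/is_trig_mxP => i j.
  case: (split_ordP i) => i' ->; case: (split_ordP j) => j' ->;
    rewrite ?block_mxEul ?block_mxEur ?block_mxEdl ?block_mxEdr ?mxE //=.
  + by rewrite !ord1.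
  + by rewrite (ord1 j').
  + by rewrite ltn_add2l; apply/is_trig_mxP.
- move=> i; case: (split_ordP i) => i' ->; rewrite ?block_mxEul ?block_mxEdr //.
  by rewrite ord1 mxE mulr1n.
Qed.

(** * Spectrum and eigenvectors of a Jacobi matrix *)

(** Multiplying a row by a tridiagonal matrix extends its support by one place; the new last entry
    is the old one times a positive superdiagonal entry. *)
Lemma jacobi_exp_row0 (R : realType) (n : nat) (A : 'M[R]_n.+1) (k : nat) :
  jacobi A ->
  (forall j : 'I_n.+1, (k < j)%N -> (A ^+ k) 0 j = 0) /\
  (forall j : 'I_n.+1, j = k :> nat -> 0 < (A ^+ k) 0 j).
Proof.
move=> [_ A0 Apos]; elim: k => [|k [IH0 IHpos]].
  rewrite expr0; split=> j; rewrite mxE.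
    by case: eqP => // <-.
  by move=> j0; rewrite (_ : 0 = j) ?eqxx ?ltr01 //; apply: val_inj.
rewrite exprSr; split=> j.
  move=> kj; rewrite mxE big1 // => l _.
  have [kl|lk] := ltnP k l; first by rewrite IH0 // mul0r.
  by rewrite A0 ?mulr0 // (leq_ltn_trans _ kj).
move=> jk; have kn : (k < n.+1)%N by rewrite ltnW // -jk.
rewrite mxE (bigD1 (Ordinal kn)) //= big1 ?addr0.
  by rewrite mulr_gt0 ?IHpos ?Apos.
move=> l; rewrite -val_eqE /= => lk.
have [kl|lk'] := ltnP k l; first by rewrite IH0 // mul0r.
by rewrite A0 ?mulr0 // jk ltnS ltn_neqAle lk lk'.
Qed.

(** The point is finiteness, without which [fset_set] would be empty: every eigenvalue is a root of
    the minimal polynomial, which divides the annihilator. *)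
Lemma mem_eigenvalues (R : realType) (n : nat) (A : 'M[R]_n.+1) (x : R) :
  A^T = A -> (x \in eigenvalues A) = eigenvalue A x.
Proof.
move=> /symmetric_annihilator[rs [_ _ annA]].
rewrite /eigenvalues in_fset_set; first by apply/idP/idP; rewrite inE.
apply: (@sub_finite_set _ _ [set` rs]) => // y /=.
rewrite eigenvalue_root_min => ry; rewrite -root_prod_XsubC.
by have /dvdpP[q ->] := mxminpoly_min annA; rewrite rootM ry orbT.
Qed.

Lemma size_eigenvalues_jacobi (R : realType) (n : nat) (A : 'M[R]_n.+1) :
  jacobi A -> size (eigenvalues A) = n.+1.
Proof.
move=> jA; have symA : A^T = A by case: jA.
apply/eqP; rewrite eqn_leq; apply/andP; split.
  have char0 : char_poly A != 0 by rewrite monic_neq0 // char_poly_monic.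
  rewrite -ltnS -(size_char_poly A); apply: max_poly_roots => //.
    by apply/allP => x; rewrite mem_eigenvalues // eigenvalue_root_char.
  exact: finmap.fset_uniq.
have [rs [urs rsA annA]] := symmetric_annihilator symA.
apply: (@leq_trans (size rs)); last first.
  by apply: uniq_leq_size => // x /rsA xA; rewrite mem_eigenvalues.
(* If [rs] had at most n elements, entry (0, size rs) of the zero matrix p(A) would receive only the
   contribution of the leading term, which is positive. *)
rewrite leqNgt; apply/negP => rsn.
set p := \prod_(x <- rs) _ in annA.
have sp : size p = (size rs).+1 by rewrite size_prod_XsubC.
have /monicP lp : p \is monic by apply: monic_prod_XsubC.
have [_ Apos] := jacobi_exp_row0 (size rs) jA.
have := Apos (Ordinal rsn) erefl.
rewrite lt_neqAle eq_sym => /andP[/eqP + _]; apply.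
have := congr1 (fun M : 'M[R]_n.+1 => M 0 (Ordinal rsn)) annA.
rewrite /= -[p]coefK poly_def rmorph_sum /= sp big_ord_recr /= [RHS]mxE.
rewrite [LHS]mxE summxE big1 ?add0r.
  rewrite horner_mxZ rmorphXn /= horner_mx_X mxE.
  by move: lp; rewrite /lead_coef sp /= => ->; rewrite mul1r.
move=> i _; rewrite horner_mxZ rmorphXn /= horner_mx_X mxE.
by rewrite (proj1 (jacobi_exp_row0 i jA)) ?mulr0 /=.
Qed.

Lemma normalized_eigenvectorP (R : realType) (n : nat) (A : 'M[R]_n.+1)
    (x : R) :
  jacobi A -> eigenvalue A x ->
  A *m normalized_eigenvector A x = x *: normalized_eigenvector A x /\
  normalized_eigenvector A x 0 0 = 1.
Proof.
move=> [symA A0 Apos] /eigenvalueP[u uA u0].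
pose w := u^T.
have Aw : A *m w = x *: w by rewrite -{1}symA -trmx_mul uA linearZ.
(* If the first component vanished, the three-term recurrence would kill all the others: once
   components 0 to k are zero, row k of A w = x w reduces to A_{k,k+1} w_{k+1} = 0. *)
have w00 : w 0 0 != 0.
  apply: contra_neq u0 => w00; apply: trmx_inj; rewrite trmx0 -/w.
  suff H k (j : 'I_n.+1) : (j <= k)%N -> w j 0 = 0.
    by apply/colP => j; rewrite (H n) ?mxE // -ltnS.
  elim: k j => [|k IH] j.
    by rewrite leqn0 => /eqP j0; rewrite (_ : j = 0) //; apply: val_inj.
  rewrite leq_eqVlt => /predU1P[jk|]; last exact: IH.
  have kn : (k < n.+1)%N by rewrite ltnW // -jk.
  move/colP/(_ (Ordinal kn)): Aw.
  rewrite mxE [RHS]mxE (IH (Ordinal kn)) // mulr0.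
  rewrite (bigD1 j) //= big1 ?addr0; last first.
    move=> l lj; have [lk|kl] := leqP l k; first by rewrite IH ?mulr0.
    rewrite A0 ?mul0r //= ltn_neqAle kl andbT.
    by apply: contra lj => /eqP kl'; rewrite -val_eqE /= jk kl'.
  move/eqP; rewrite mulf_eq0 gt_eqF //=; first by move/eqP.
  exact: Apos.
have : (exists v : 'cV[R]_n.+1, [set v : 'cV[R]_n.+1 | A *m v = x *: v /\
    forall i : 'I_n.+1, i = 0%N :> nat -> v i 0 = 1] v).
  exists ((w 0 0)^-1 *: w); split.
    by rewrite -scalemxAr Aw !scalerA mulrC.
  move=> i i0; have -> : i = 0 by exact: val_inj.
  by rewrite mxE mulVf.
by move/(xgetPex 0) => [? h]; split=> //; apply: h.
Qed.

Lemma norming_constant_gt0 (R : realType) (n : nat) (A : 'M[R]_n.+1) (x : R) :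
  jacobi A -> x \in eigenvalues A -> 0 < norming_constant A x.
Proof.
move=> jA; rewrite mem_eigenvalues; last by case: jA.
move=> /(normalized_eigenvectorP jA)[_ v00].
rewrite /norming_constant (bigD1 0) //= v00 expr1n.
by rewrite ltr_pwDl // sumr_ge0 // => j _; apply: sqr_ge0.
Qed.

(** With the normalized eigenvectors as rows of [V], V V^T is the diagonal matrix of norming
    constants, which yields the inverse [W] and A^k = W diag(x^k) V. Entry (0, 0) involves only
    first components, all equal to 1. *)
Lemma jacobi_exp00 (R : realType) (n : nat) (A : 'M[R]_n.+1) (k : nat) :
  jacobi A ->
  (A ^+ k) 0 0 =
  \sum_(x <- eigenvalues A) (norming_constant A x)^-1 * x ^+ k.
Proof.
move=> jA; have symA : A^T = A by case: jA.
set E := eigenvalues A.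
have sE : size E = n.+1 := size_eigenvalues_jacobi jA.
have uE : uniq E := finmap.fset_uniq _.
have evE (i : 'I_n.+1) : eigenvalue A E`_i.
  by rewrite -mem_eigenvalues // mem_nth ?sE.
pose v (i : 'I_n.+1) := normalized_eigenvector A E`_i.
have vP i : A *m v i = E`_i *: v i /\ v i 0 0 = 1 :=
  normalized_eigenvectorP jA (evE i).
pose V : 'M[R]_n.+1 := \matrix_(i, j) v i j 0.
have rowV i : row i V = (v i)^T by apply/rowP => j; rewrite !mxE.
have rho_gt0 (i : 'I_n.+1) : 0 < norming_constant A E`_i.
  by rewrite norming_constant_gt0 // mem_nth ?sE.
have VVT : V *m V^T = diag_mx (\row_i norming_constant A E`_i).
  apply/matrixP => i j.
  have -> : (V *m V^T) i j = ((v i)^T *m v j) 0 0.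
    by rewrite !mxE; apply: eq_bigr => l _; rewrite !mxE.
  rewrite !mxE; have [->|ij] := eqVneq i j.
    by rewrite mulr1n; apply: eq_bigr => l _; rewrite !mxE expr2.
  rewrite mulr0n.
  (* Orthogonality: v_i^T A v_j is evaluated with [A] acting on either side, and the two eigenvalues
     differ. *)
  have : E`_i * ((v i)^T *m v j) 0 0 = E`_j * ((v i)^T *m v j) 0 0.
    have := congr1 (fun M : 'M[R]_1 => M 0 0) (mulmxA (v i)^T A (v j)).
    rewrite (vP j).1 -{1}symA -trmx_mul (vP i).1 linearZ /=.
    by rewrite [(E`_i *: v i)^T]linearZ /= -scalemxAl [LHS]mxE [RHS]mxE => ->.
  move/eqP; rewrite -subr_eq0 -mulrBl mulf_eq0 subr_eq0 nth_uniq ?sE //.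
  by rewrite -[(i == j :> nat)]/(i == j) (negPf ij) /= mxE => /eqP.
pose W := V^T *m diag_mx (\row_i (norming_constant A E`_i)^-1).
have WV : W *m V = 1%:M.
  apply: mulmx1C; rewrite mulmxA VVT mulmx_diag -diag_const_mx; congr diag_mx.
  by apply/rowP => i; rewrite !mxE divff ?gt_eqF.
have VA : V *m A ^+ k = diag_mx (\row_i E`_i ^+ k) *m V.
  apply/row_matrixP => i.
  rewrite !row_mul row_diag_mx -scalemxAl -rowE !rowV mxE.
  elim: k => [|k IH]; first by rewrite !expr0 mulmx1 scale1r.
  rewrite exprSr -[A ^+ k * A]/(A ^+ k *m A) mulmxA IH -scalemxAl.
  by rewrite -{1}symA -trmx_mul (vP i).1 linearZ scalerA exprSr.
have -> : A ^+ k = W *m (diag_mx (\row_i E`_i ^+ k) *m V).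
  by rewrite -VA mulmxA WV mul1mx.
rewrite (big_nth 0) sE big_mkord mxE; apply: eq_bigr => i _.
by rewrite /W mul_mx_diag mul_diag_mx !mxE (vP i).2 mul1r mulr1.
Qed.

(** * The spectral measure as a finite sum of atoms *)

Lemma spectral_measureE (R : realType) (N : nat) (A : 'M[R]_N) (D : set R) :
  spectral_measure A D =
  (\sum_(x <- eigenvalues A) (norming_constant A x)^-1 * (x \in D)%:R)%:E.
Proof.
rewrite /spectral_measure /= /msum (big_nth 0) big_mkord -sumEFin.
apply: eq_bigr => i _.
transitivity ((norming_constant A (nth 0%R (eigenvalues A) i))^-1%:E *
    @dirac _ (measurableTypeR R) (nth 0%R (eigenvalues A) i) R D)%E => //.
Qed.

(** Integration against a sum of scaled Dirac masses is first computed for nonnegative functions,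
    then applied to the positive and negative parts of [f]. *)
Lemma integral_spectral_measure (R : realType) (N : nat) (A : 'M[R]_N)
    (f : R -> R) :
  measurable_fun setT f ->
  (\int[spectral_measure A]_x (f x)%:E)%E =
  (\sum_(x <- eigenvalues A) (norming_constant A x)^-1 * f x)%:E.
Proof.
move=> mf; rewrite integralE.
have mF : measurable_fun setT (fun x : measurableTypeR R => (f x)%:E).
  exact/measurable_EFinP.
have ge0_intE (g : measurableTypeR R -> \bar R) :
    (forall x, 0 <= g x)%E -> measurable_fun setT g ->
    (\int[spectral_measure A]_x g x =
     \sum_(i < size (eigenvalues A))
       (norming_constant A (nth 0%R (eigenvalues A) i))^-1%:E *
       g (nth 0%R (eigenvalues A) i))%E.
  move=> g0 mg; rewrite ge0_integral_measure_sum //=; apply: eq_bigr => i _.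
  by rewrite ge0_integral_mscale //= integral_dirac // diracT mul1e.
have mFp := measurable_funepos mF; have mFn := measurable_funeneg mF.
rewrite !ge0_intE // (big_nth 0) big_mkord.
under eq_bigr do rewrite funeposE -[0%E]/(0%:E) -EFin_max -EFinM.
under [X in (_ - X)%E]eq_bigr do
  rewrite funenegE -EFinN -[0%E]/(0%:E) -EFin_max -EFinM.
rewrite !sumEFin -EFinB -sumrB; congr (_%:E); apply: eq_bigr => i _.
rewrite -mulrBr; congr (_ * _); set y := f _.
have [y_ge0|/ltW y_le0] := lerP 0 y.
  by rewrite max_r ?subr0 // oppr_le0.
by rewrite max_l ?sub0r ?opprK // oppr_ge0.
Qed.

Lemma supported_on_spectral_measure (R : realType) (n : nat) (A : 'M[R]_n.+1)
    (D : set R) :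
  jacobi A ->
  supported_on (spectral_measure A) D <-> {in eigenvalues A, forall x, D x}.
Proof.
move=> jA; rewrite /supported_on spectral_measureE; split.
  move=> /eqP; rewrite eqe psumr_eq0; last first.
    move=> x _; rewrite mulr_ge0 ?norming_constantV_ge0 //.
  move=> /allP h x xA; have := h x xA.
  rewrite mulf_eq0 invr_eq0 gt_eqF ?norming_constant_gt0 //= pnatr_eq0 eqb0.
  by rewrite in_setC negbK inE.
move=> h; congr (_%:E); rewrite big_seq big1 // => x /h Dx.
by rewrite (_ : (x \in ~` D) = false) ?mulr0 // in_setC mem_set.
Qed.

(** * Hankel forms of a finite sum of atoms *)

(** With N = n+1 the index 2N-(i+1)-(j+1) is (n-i)+(n-j): an ordinary Hankel matrix with both
    indices reversed. *)
Lemma hankelE (R : realType) (n m : nat) (s : nat -> R) (i j : 'I_n.+1) :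
  hankel n.+1 m s i j = s (rev_ord i + rev_ord j + m)%N.
Proof.
rewrite mxE; congr (s (_ + m)%N).
have -> : (rev_ord i + rev_ord j = (n - i) + (n - j))%N by [].
by have := ltn_ord i; have := ltn_ord j; lia.
Qed.

Lemma trmx_hankel (R : realType) (n m : nat) (s : nat -> R) :
  (hankel n m s)^T = hankel n m s.
Proof. by apply/matrixP => i j; rewrite !mxE subnAC. Qed.

Lemma hankel_quadE (R : realType) (n m : nat) (s : nat -> R) (E : seq R)
    (w : R -> R) (v : 'cV[R]_n.+1) :
  (m <= 1)%N ->
  (forall k, (k < 2 * n.+1)%N -> s k = \sum_(x <- E) w x * x ^+ k) ->
  (v^T *m hankel n.+1 m s *m v) 0 0 =
  \sum_(x <- E)
    w x * x ^+ m * (\poly_(i < n.+1) v (rev_ord (inord i)) 0).[x] ^+ 2.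
Proof.
move=> m1 sE; rewrite mx_quadE.
transitivity (\sum_(i < n.+1) \sum_(j < n.+1)
    \sum_(x <- E) (w x * x ^+ m) *
      ((v i 0 * x ^+ rev_ord i) * (v j 0 * x ^+ rev_ord j))).
  apply: eq_bigr => i _; apply: eq_bigr => j _.
  (* The largest index is 2n+m; [m] being at most 1 keeps it below 2(n+1). *)
  rewrite hankelE sE; last first.
    by have := ltn_ord (rev_ord i); have := ltn_ord (rev_ord j); lia.
  by rewrite big_distrr; apply: eq_bigr => x _ /=; rewrite !exprD; ring.
under eq_bigr do rewrite exchange_big.
rewrite exchange_big; apply: eq_bigr => x _ /=.
have -> : (\poly_(i < n.+1) v (rev_ord (inord i)) 0).[x] =
    \sum_(i < n.+1) v i 0 * x ^+ rev_ord i.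
  rewrite horner_poly (reindex_inj rev_ord_inj) /=; apply: eq_bigr => i _.
  by rewrite (inord_val (rev_ord i)) rev_ordK.
rewrite expr2 big_distrlr big_distrr /=; apply: eq_bigr => i _.
by rewrite big_distrr.
Qed.

Lemma hankel_posdef (R : realType) (n m : nat) (s : nat -> R) (E : seq R)
    (w : R -> R) :
  (m <= 1)%N ->
  (forall k, (k < 2 * n.+1)%N -> s k = \sum_(x <- E) w x * x ^+ k) ->
  uniq E -> size E = n.+1 -> {in E, forall x, 0 < w x} ->
  {in E, forall x, 0 < x} -> posdefmx (hankel n.+1 m s).
Proof.
move=> m1 sE uE szE w_gt0 E_gt0; split; first exact: trmx_hankel.
move=> v; apply: contra_neqT; rewrite (hankel_quadE v m1 sE) => h.
set p := \poly_(i < _) _ in h.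
have term_ge0 x : x \in E -> 0 <= w x * x ^+ m * p.[x] ^+ 2.
  move=> xE; rewrite mulr_ge0 ?sqr_ge0 // mulr_ge0 // ltW ?w_gt0 //.
  by rewrite exprn_gt0 ?E_gt0.
(* A node where [p] is nonzero would make the form positive, so [p], of degree at most n, vanishes
   at n+1 distinct nodes. *)
have p0 : p = 0.
  apply: (@roots_geq_poly_eq0 _ p E) => //; last by rewrite szE size_poly.
  apply/allP => x xE; apply: contraNT h => px.
  rewrite (big_rem x) //= ltr_pwDl //.
    have px2 : 0 < p.[x] ^+ 2 by rewrite exprn_even_gt0.
    by rewrite mulr_gt0 // mulr_gt0 ?w_gt0 // exprn_gt0 ?E_gt0.
  by rewrite big_seq sumr_ge0 // => y /mem_rem; apply: term_ge0.
apply/colP => i; have := congr1 (fun q : {poly R} => q`_(rev_ord i)) p0.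
by rewrite coef_poly ltn_ord inord_val rev_ordK coef0 mxE.
Qed.

(** The form of the difference weights the squares p(x)^2 by w(x)(1-x), which is nonnegative at
    every node. *)
Lemma hankelB_possemidef (R : realType) (n : nat) (s : nat -> R) (E : seq R)
    (w : R -> R) :
  (forall k, (k < 2 * n.+1)%N -> s k = \sum_(x <- E) w x * x ^+ k) ->
  {in E, forall x, 0 <= w x} -> {in E, forall x, x <= 1} ->
  possemidefmx (hankel n.+1 0 s - hankel n.+1 1 s).
Proof.
move=> sE w_ge0 E_le1; split; first by rewrite linearB /= !trmx_hankel.
move=> v.
have entryB (U V : 'M[R]_1) : (U - V) 0 0 = U 0 0 - V 0 0 by rewrite !mxE.
rewrite mulmxBr mulmxBl entryB !(hankel_quadE v _ sE) // -sumrB.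
rewrite big_seq sumr_ge0 // => x xE.
rewrite -mulrBl -mulrBr expr0 expr1 mulr_ge0 ?sqr_ge0 // mulr_ge0 ?w_ge0 //.
by rewrite subr_ge0 E_le1.
Qed.

(** * Reconstruction of the Jacobi matrix from its moments *)

Lemma jacobi_of_hankel (R : realType) (n : nat) (s : nat -> R) :
  let H m : 'M[R]_n.+1 := \matrix_(i, j) s (i + j + m)%N in
  s 0%N = 1 -> posdefmx (H 0%N) ->
  exists A L : 'M[R]_n.+1,
    [/\ jacobi A, L \in unitmx, H 0%N = L *m L^T, H 1%N = L *m A *m L^T &
        forall k, (k < 2 * n.+1)%N -> (A ^+ k) 0 0 = s k].
Proof.
move=> H s0 /posdefmx_cholesky[L [T [H0E LT]]].
move=> /is_trig_mxP trL /is_trig_mxP trT Lpos.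
have TL : T *m L = 1%:M := mulmx1C LT.
have LTT : T^T *m L^T = 1%:M by rewrite -trmx_mul LT trmx1.
pose A := T *m H 1%N *m T^T.
have H1E : H 1%N = L *m A *m L^T.
  by rewrite /A !mulmxA LT mul1mx -mulmxA LTT mulmx1.
have symH : (H 1%N)^T = H 1%N by apply/matrixP => i j; rewrite !mxE (addnC i).
have symA : A^T = A by rewrite /A !trmx_mul trmxK symH mulmxA.
(* The shift property: A L^T = T H_1 and L^T = T H_0, and column l of H_1 is column l+1 of H_0. The
   last column has no successor, whence the bound on [l]. *)
have ALE (i l : 'I_n.+1) : (l < n)%N -> (A *m L^T) i l = L (inord l.+1) i.
  move=> ln; have -> : A *m L^T = T *m H 1%N by rewrite /A -mulmxA LTT mulmx1.
  have -> : L (inord l.+1) i = (T *m H 0%N) i (inord l.+1).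
    by rewrite H0E mulmxA TL mul1mx mxE.
  rewrite mxE [RHS]mxE; apply: eq_bigr => j _; rewrite !mxE inordK ?ltnS //.
  by congr (_ * s _); lia.
have AE : A = (A *m L^T) *m T^T by rewrite -mulmxA -trmx_mul TL trmx1 mulmx1.
have Alow (i j : 'I_n.+1) : (j.+1 < i)%N -> A i j = 0.
  move=> ji; rewrite AE mxE big1 // => l _; rewrite [T^T _ _]mxE.
  have [jl|lj] := ltnP j l; first by rewrite trT ?mulr0.
  have ln : (l < n)%N by have := ltn_ord i; lia.
  by rewrite ALE // trL ?mul0r // inordK ?ltnS //; lia.
have Tpos j : 0 < T j j.
  have : (L *m T) j j = 1 by rewrite LT mxE eqxx.
  rewrite mxE (bigD1 j) //= big1 ?addr0.
    by move=> LTj; rewrite -(pmulr_rgt0 _ (Lpos j)) LTj ltr01.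
  move=> l; rewrite -val_eqE /= => lj.
  have [jl|lj'] := ltnP j l; first by rewrite trL ?mul0r.
  by rewrite trT ?mulr0 // ltn_neqAle lj.
(* Only l = j contributes, giving the entry L_{ii} T_{jj}. *)
have Asub (i j : 'I_n.+1) : i = j.+1 :> nat -> 0 < A i j.
  move=> ij; have jn : (j < n)%N by have := ltn_ord i; lia.
  rewrite AE mxE (bigD1 j) //= big1 ?addr0.
    rewrite ALE // [T^T _ _]mxE mulr_gt0 //.
    by have -> : inord j.+1 = i by apply/val_inj; rewrite /= inordK ?ij.
  move=> l; rewrite -val_eqE /= => lj; rewrite [T^T _ _]mxE.
  have [jl|lj'] := ltnP j l; first by rewrite trT ?mulr0.
  have ln : (l < n)%N by lia.
  by rewrite ALE // trL ?mul0r // inordK ?ltnS //; lia.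
have jA : jacobi A.
  split=> // i j ij; rewrite -symA mxE; [exact: Alow | exact: Asub].
(* The normalization s_0 = 1 gives L_{00}^2 = 1, and positivity of the diagonal selects the root 1;
   this starts the induction in [powE]. *)
have L0 i : L 0 i = (i == 0)%:R.
  have [->|i0] := eqVneq i 0; last by rewrite trL // lt0n.
  have := congr1 (fun M : 'M[R]_n.+1 => M 0 0) H0E.
  rewrite mxE s0 mxE big_ord_recl big1 ?addr0.
    rewrite mxE -expr2 => /esym/eqP; rewrite sqrf_eq1 => /orP[/eqP //|/eqP L00].
    by have := Lpos 0; rewrite L00 oppr_gt0 ltr10.
  by move=> j _; rewrite trL ?mul0r.
have symAX k : (A ^+ k)^T = A ^+ k.
  elim: k => [|k IH]; first by rewrite expr0 trmx1.
  by rewrite {1}exprSr [LHS]trmx_mul IH symA exprS.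
have powE k (i : 'I_n.+1) : (k <= n)%N -> (A ^+ k) i 0 = L (inord k) i.
  elim: k i => [|k IH] i kn.
    have -> : inord 0 = 0 :> 'I_n.+1 by apply/val_inj/inordK.
    by rewrite L0 expr0 mxE.
  have ek : (inord k : 'I_n.+1) = k :> nat by rewrite inordK // ltnS ltnW.
  rewrite exprS; have := ALE i (inord k); rewrite ek => <- //.
  rewrite mxE [RHS]mxE; apply: eq_bigr => j _.
  by rewrite IH 1?ltnW // [L^T _ _]mxE.
exists A, L; split => //; first by case: (mulmx1_unit LT).
(* Splitting A^k as A^j A^m A^j, with [m] the parity of [k], keeps [j] at most n, the range of
   [powE]. *)
move=> k kn; pose j := k./2; pose m : nat := odd k.
have kE : k = (j + m + j)%N.
  by rewrite /j /m -{1}(odd_double_half k) -addnn; lia.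
have jn : (j <= n)%N by have := kE; lia.
have -> : (A ^+ k) 0 0 = (L *m A ^+ m *m L^T) (inord j) (inord j).
  rewrite {1}kE !exprD mxE [RHS]mxE; apply: eq_bigr => q _.
  rewrite powE // [L^T _ _]mxE; congr (_ * _).
  rewrite mxE [RHS]mxE; apply: eq_bigr => p _; congr (_ * _).
  by rewrite -powE // -[in LHS]symAX mxE.
have -> : L *m A ^+ m *m L^T = H m.
  by rewrite /m; case: (odd k); rewrite ?expr1 ?expr0 ?mulmx1 -?H0E -?H1E.
by rewrite mxE !inordK // [in RHS]kE addnAC.
Qed.

(** * Moments on ]0, 1] and the Hankel inequalities *)

Theorem proposition9 (R : realType) (N : nat) (hN : (0 < N)%N)
    (s : nat -> R) (hs0 : s 0%N = 1) :
  (exists A : 'M[R]_N,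
      [/\ jacobi A,
          supported_on (spectral_measure A) `]0, 1]%classic &
          forall k : nat, (k < 2 * N)%N ->
            (s k)%:E = (\int[spectral_measure A]_x (x ^+ k)%:E)%E])
  <->
  possemidefmx (hankel N 0 s - hankel N 1 s) /\ posdefmx (hankel N 1 s).
Proof.
case: N hN => // n _.
have momentE (A : 'M[R]_n.+1) k : (\int[spectral_measure A]_x (x ^+ k)%:E)%E =
    (\sum_(x <- eigenvalues A) (norming_constant A x)^-1 * x ^+ k)%:E.
  by rewrite integral_spectral_measure //; apply: measurable_funX.
split=> [[A [jA suppA sA]]|[[_ H01] posH1]].
  move: suppA => /(supported_on_spectral_measure _ jA) suppA.
  have sE k : (k < 2 * n.+1)%N ->
      s k = \sum_(x <- eigenvalues A) (norming_constant A x)^-1 * x ^+ k.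
    by move=> /sA; rewrite momentE => -[].
  have w_gt0 : {in eigenvalues A, forall x, 0 < (norming_constant A x)^-1}.
    by move=> x xA; rewrite invr_gt0 norming_constant_gt0.
  split.
    apply: (hankelB_possemidef sE) => x xA; first exact/ltW/w_gt0.
    by have := suppA x xA; rewrite /= in_itv /= => /andP[].
  apply: (hankel_posdef _ sE) => //; first exact: finmap.fset_uniq.
    exact: size_eigenvalues_jacobi.
  by move=> x xA; have := suppA x xA; rewrite /= in_itv /= => /andP[].
(* Both hypotheses are transported to the unreversed matrices, for which the shift property takes
   its usual form. *)
pose H m : 'M[R]_n.+1 := \matrix_(i, j) s (i + j + m)%N.
have HE m : H m = mxsub (@rev_ord n.+1) (@rev_ord n.+1) (hankel n.+1 m s).
  by apply/matrixP => i j; rewrite [RHS]mxE hankelE !rev_ordK mxE.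
have entryB (U V : 'M[R]_1) : (U - V) 0 0 = U 0 0 - V 0 0 by rewrite !mxE.
have H0_ge (v : 'cV[R]_n.+1) :
    (v^T *m H 1%N *m v) 0 0 <= (v^T *m H 0%N *m v) 0 0.
  rewrite !HE !mx_quad_mxsub; try exact: rev_ordK.
  by rewrite -subr_ge0 -entryB -mulmxBl -mulmxBr.
have H1_gt0 (v : 'cV[R]_n.+1) : v != 0 -> 0 < (v^T *m H 1%N *m v) 0 0.
  move=> v0; rewrite HE mx_quad_mxsub; last exact: rev_ordK.
  apply: posH1.2; apply: contra_neq v0 => rv0; apply/colP => i.
  by move/colP/(_ (rev_ord i)): rv0; rewrite !mxE rev_ordK.
have posH0 : posdefmx (H 0%N).
  split; first by apply/matrixP => i j; rewrite !mxE (addnC i).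
  by move=> v v0; apply: lt_le_trans (H1_gt0 v v0) (H0_ge v).
have [A [L [jA Lunit H0E H1E AX]]] := jacobi_of_hankel hs0 posH0.
exists A; split=> //; last by move=> k kn; rewrite momentE -jacobi_exp00 // AX.
apply/supported_on_spectral_measure => // x.
rewrite mem_eigenvalues; last by case: jA.
move=> /(normalized_eigenvectorP jA)[].
set v := normalized_eigenvector A x => Av v00.
(* The vector u = L^-T v is an eigenvector of the pencil (H_1, H_0): its two forms are x (v, v) and
   (v, v), so 0 < H_1 <= H_0 places [x] in ]0, 1]. *)
have [u LTu] : exists u, L^T *m u = v.
  by exists ((invmx L)^T *m v); rewrite mulmxA -trmx_mul mulVmx // trmx1 mul1mx.
have uL : u^T *m L = v^T by rewrite -LTu [RHS]trmx_mul trmxK.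
have u0 : u != 0.
  apply: contraTneq (oner_neq0 R) => u0.
  by rewrite -v00 -LTu u0 mulmx0 mxE eqxx.
have quad0 : (u^T *m H 0%N *m u) 0 0 = (v^T *m v) 0 0.
  by rewrite /H H0E mulmxA uL -mulmxA LTu.
have quad1 : (u^T *m H 1%N *m u) 0 0 = x * (v^T *m v) 0 0.
  by rewrite /H H1E !mulmxA uL -!mulmxA LTu Av -scalemxAr mxE.
have := H0_ge u; have := H1_gt0 u u0; rewrite quad0 quad1 => xv_gt0 xv_le.
have vv_gt0 : 0 < (v^T *m v) 0 0 := lt_le_trans xv_gt0 xv_le.
by rewrite /= in_itv /= -(pmulr_lgt0 _ vv_gt0) xv_gt0 -(ler_pM2r vv_gt0) mul1r.
Qed.
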